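(* Let $u,v,w$ be weights such that $w$ is dyadic doubling and $u^{-1}w^2, v\in L^1_{\mathrm{loc}}(\mathbb{R})$. Then the weighted dyadic square function $S_w^d$ is bounded from $L^2(u)$ into $L^2(v)$ if and only if both of the following hold: (i) $(uw^{-1},vw^{-1})\in A_2^d(w)$, that is, $\sup_{J\in\mathcal{D}}\langle u^{-1}w\rangle_J^w\,\langle vw^{-1}\rangle_J^w<\infty$; (ii) there is a constant $C>0$ such that for all $J\in\mathcal{D}$, $$\frac{1}{w(J)}\sum_{I\in\mathcal{D}(J)}\big|\Delta_I^w(u^{-1}w)\big|^2\left[\frac{w(I^-)^2\,v(I^+)+w(I^+)^2\,v(I^-)}{w(I)^2}\right]\le C\,\langle u^{-1}w\rangle_J^w .$$
   Context: A weight is an almost everywhere positive, locally integrable function on $\mathbb{R}$. $\mathcal{D}$ is the family of dyadic intervals $[k2^{-j},(k+1)2^{-j})$, $k,j\in\mathbb{Z}$; for $J\in\mathcal{D}$, $\mathcal{D}(J)=\{I\in\mathcal{D}: I\subset J\}$. For $I\in\mathcal{D}$, $I^+$ and $I^-$ are its right and left halves (children) and $\widetilde I\in\mathcal D$ is its dyadic parent. For a weight $\omega$, $\omega(I)=\int_I\omega(x)\,dx$; $\omega$ is dyadic doubling if $\sup_{I\in\mathcal{D}}\omega(\widetilde I)/\omega(I)<\infty$. The weighted average of $f$ with respect to $w$ is $\langle f\rangle_I^w=\frac{1}{w(I)}\int_I f(x)w(x)\,dx$, and $\Delta_I^w(g)=\langle g\rangle_{I^+}^w-\langle g\rangle_{I^-}^w$.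 $(a,b)\in A_2^d(w)$ means $\sup_{I\in\mathcal{D}}\langle a^{-1}\rangle_I^w\langle b\rangle_I^w<\infty$. $L^2(u)$ denotes $L^2(\mathbb{R},u\,dx)$. The weighted dyadic square function (also written $S_w$) is $$S_w^df(x)=\Big(\sum_{I\in\mathcal{D}}|\langle f\rangle_I^w-\langle f\rangle_{\widetilde I}^w|^2\,\mathbf{1}_I(x)\Big)^{1/2}.$$ It is bounded from $L^2(u)$ into $L^2(v)$ if there is a constant $C>0$ with $\|S_w^df\|_{L^2(v)}\le C\|f\|_{L^2(u)}$ for all $f\in L^2(u)$. *)

(* Defs.v *)
From HB Require Import structures.
From mathcomp Require Import all_boot all_order all_algebra.
From mathcomp Require Import all_classical all_reals all_analysis.
From mathcomp Require Import ring lra zify.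
Set Implicit Arguments.
Unset Strict Implicit.
Unset Printing Implicit Defensive.
Import Order.TTheory GRing.Theory Num.Theory.
Import numFieldNormedType.Exports.
Local Open Scope classical_set_scope.
Local Open Scope ring_scope.

(* The pair (j, k) stands for the interval [k 2^-j, (k+1) 2^-j); this encoding
   is injective (dyadic_set_inj), so sums over pairs are sums over intervals. *)
Notation dyadic := (int * int)%type.

Definition dyadic_set (R : realType) (I : dyadic) : set R :=
  `[I.2%:~R * 2 ^ (- I.1), (I.2 + 1)%:~R * 2 ^ (- I.1)[.
Arguments dyadic_set : clear implicits.

Definition lchild (I : dyadic) : dyadic := (I.1 + 1, 2 * I.2).
Definition rchild (I : dyadic) : dyadic := (I.1 + 1, 2 * I.2 + 1).
(* The quotient is the floor of I.2 / 2, also for negative I.2. *)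
Definition parent (I : dyadic) : dyadic := (I.1 - 1, (I.2 %/ 2)%Z).

Definition subdyadics (R : realType) (J : dyadic) : set dyadic :=
  [set I | dyadic_set R I `<=` dyadic_set R J].

Section dyadic_encoding.
Variable R : realType.
Implicit Type I : dyadic.

Lemma dyadic_set_inj : injective (dyadic_set R).
Proof.
have lohi (j k : int) : k%:~R * 2 ^ (- j) < (k + 1)%:~R * 2 ^ (- j) :> R.
  by rewrite ltr_pM2r ?exprz_gt0// ltr_int ltrDl.
have inf_sup I : inf (dyadic_set R I) = I.2%:~R * 2 ^ (- I.1) /\
                 sup (dyadic_set R I) = (I.2 + 1)%:~R * 2 ^ (- I.1).
  by rewrite /dyadic_set; split; [rewrite inf_itv|rewrite sup_itv];
    rewrite //= bnd_simp lohi.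
move=> [j k] [j' k'] E.
have [/= i1 s1] := inf_sup (j, k); have [/= i2 s2] := inf_sup (j', k').
rewrite E i2 in i1; rewrite E s2 in s1.
have len : 2 ^ (- j') = 2 ^ (- j) :> R.
  move: s1; rewrite !intrD !mulrDl i1 !mul1r; exact: addrI.
have ej : j = j'.
  apply/oppr_inj/esym; apply: (@ieexprIz R 2) => //.
  by rewrite eq_sym lt_eqF// ltr1n.
move: i1; rewrite len => /mulIf; rewrite expfz_neq0// => /(_ isT)/intr_inj ->.
by rewrite ej.
Qed.

Lemma lchildK : cancel lchild parent.
Proof. by case=> j k; rewrite /lchild /parent /=; congr pair; lia. Qed.

Lemma rchildK : cancel rchild parent.
Proof. by case=> j k; rewrite /rchild /parent /=; congr pair; lia. Qed.

Lemma dyadic_setU I :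
  dyadic_set R I = dyadic_set R (lchild I) `|` dyadic_set R (rchild I).
Proof.
case: I => j k; rewrite /dyadic_set /lchild /rchild /=.
have -> : 2 ^ (- (j + 1)) = 2 ^ (- j) / 2 :> R.
  by rewrite opprD expfzDr// exprN1.
have p : 0 < 2 ^ (- j) :> R by rewrite exprz_gt0.
rewrite !intrD !intrM; set h := 2 ^ (- j) in p *; set q := k%:~R : R.
apply/seteqP; split => x /=; rewrite !in_itv/=.
  move=> /andP[h1 h2].
  have [h3|h3] := ltP x ((2 * q + 1) * (h / 2)); [left|right].
    by apply/andP; split; lra.
  by apply/andP; split; lra.
by case=> /andP[h1 h2]; apply/andP; split; lra.
Qed.

End dyadic_encoding.

Definition weight (R : realType) (w : R -> R) : Prop :=
  locally_integrable setT w /\ {ae lebesgue_measure, forall x : R, 0 < w x}.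

Definition mass (R : realType) (w : R -> R) (I : dyadic) : R :=
  \int[lebesgue_measure]_(x in dyadic_set R I) w x.

Definition wavg (R : realType) (w f : R -> R) (I : dyadic) : R :=
  (mass w I)^-1 * \int[lebesgue_measure]_(x in dyadic_set R I) (f x * w x).

Definition wDelta (R : realType) (w g : R -> R) (I : dyadic) : R :=
  wavg w g (rchild I) - wavg w g (lchild I).

Definition dyadic_doubling (R : realType) (w : R -> R) : Prop :=
  (ereal_sup [set (mass w (parent I) / mass w I)%:E | I in [set: dyadic]]
    < +oo)%E.

Definition dyadic_A2 (R : realType) (w a b : R -> R) : Prop :=
  (ereal_sup [set (wavg w (fun x => (a x)^-1) I * wavg w b I)%:E
             | I in [set: dyadic]] < +oo)%E.

Definition sqfun (R : realType) (w f : R -> R) (x : R) : \bar R :=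
  sqrte (\esum_(I in [set: dyadic])
    (`|wavg w f I - wavg w f (parent I)| ^+ 2 * \1_(dyadic_set R I) x)%:E)%E.

Definition L2norm (R : realType) (u : R -> R) (g : R -> \bar R) : \bar R :=
  sqrte (\int[lebesgue_measure]_(x in [set: R]) (`|g x| ^+ 2 * (u x)%:E))%E.

Definition in_L2 (R : realType) (u f : R -> R) : Prop :=
  measurable_fun [set: R] f /\ (L2norm u (EFin \o f) < +oo)%E.

Definition sqfun_bounded (R : realType) (w u v : R -> R) : Prop :=
  exists2 C : R, 0 < C & forall f : R -> R, in_L2 u f ->
    (L2norm v (sqfun w f) <= C%:E * L2norm u (EFin \o f))%E.

(* Main.v *)
Require Import Defs.
From HB Require Import structures.
From mathcomp Require Import all_boot all_order all_algebra.
From mathcomp Require Import all_classical all_reals all_analysis.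
From mathcomp Require Import measurable_realfun.
From mathcomp Require Import ring lra zify.
Set Implicit Arguments.
Unset Strict Implicit.
Unset Printing Implicit Defensive.
Import Order.TTheory GRing.Theory Num.Theory.
Import numFieldNormedType.Exports.
Local Open Scope classical_set_scope.
Local Open Scope ring_scope.

(* For a dyadic interval I write W = w(I), V = v(I), s = int_I u^-1 w^2,
   H = int_I f w and F = int_I f^2 u; all are additive over the two children and
   H^2 <= F s by Cauchy-Schwarz.  Grouping the terms of the square function by
   parents gives ||S f||_{L2(v)}^2 = sum_I |Delta_I f|^2 lam_I, where lam_I is
   the bracket in (ii).
   Necessity: test f = u^-1 w 1_J.  Keeping only the intervals inside J gives
   (ii); keeping only the parent of J, where f vanishes on the sibling, gives (i)
   by doubling.
   Sufficiency: Delta_I f splits into the jump of s/W times H/s, summed by the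
   Carleson embedding theorem with (ii) as Carleson condition, and the jumps of
   H/s times the values of s/W, summed by Bessel's inequality with (i) and
   doubling.  Both are run at once by telescoping a Bellman-type potential over
   finite dyadic trees. *)

(** * Real inequalities on one interval and its two halves *)

Lemma sqr_add_div_le (R : realFieldType) (a b x y : R) : 0 < x -> 0 < y ->
  (a + b) ^+ 2 / (x + y) <= a ^+ 2 / x + b ^+ 2 / y.
Proof.
move=> x0 y0; have xy0 : 0 < x + y by rewrite addr_gt0.
rewrite -subr_ge0.
(* The defect is an explicit square over a positive denominator; this expresses the joint convexity
   of [a ^+ 2 / x]. *)
have -> : a ^+ 2 / x + b ^+ 2 / y - (a + b) ^+ 2 / (x + y) =
    (a * y - b * x) ^+ 2 / (x * y * (x + y)).
  by field; rewrite !gt_eqF.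
by rewrite divr_ge0 ?sqr_ge0// !mulr_ge0// ltW.
Qed.

Lemma sqr_add3_le (R : realFieldType) (x y z : R) :
  (x + y - z) ^+ 2 <= 3 * (x ^+ 2 + y ^+ 2 + z ^+ 2).
Proof.
have := sqr_ge0 (x - y); have := sqr_ge0 (x + z); have := sqr_ge0 (y + z).
nra.
Qed.

(** The Bellman function is [h ^+ 2 / (K * s + m)]. Convexity pays for splitting [(s, h, Ml + Mr)]
    between the halves. Raising [m] from [Ml + Mr] to [M] lowers the function by
    [h ^+ 2 * (M - (Ml + Mr))] over the product of the two denominators, and [M - (Ml + Mr)] is at
    least [a]. *)
Lemma carleson_step (R : realFieldType) (K sl sr hl hr a M Ml Mr : R) :
  0 < K -> 0 < sl -> 0 < sr -> 0 <= a -> 0 <= Ml -> 0 <= Mr ->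
  a + Ml + Mr <= M -> M <= K * (sl + sr) ->
  a * ((hl + hr) / (sl + sr)) ^+ 2 <=
  4 * K ^+ 2 * (hl ^+ 2 / (K * sl + Ml) + hr ^+ 2 / (K * sr + Mr) -
                (hl + hr) ^+ 2 / (K * (sl + sr) + M)).
Proof.
move=> K0 sl0 sr0 a0 Ml0 Mr0 aM MK.
set s := sl + sr in MK *; set h := hl + hr.
have s0 : 0 < s by rewrite addr_gt0.
have Ks0 : 0 < K * s by rewrite mulr_gt0.
have xl0 : 0 < K * sl + Ml by rewrite ltr_wpDr// mulr_gt0.
have xr0 : 0 < K * sr + Mr by rewrite ltr_wpDr// mulr_gt0.
have N0 : 0 < K * s + (Ml + Mr) by rewrite ltr_wpDr// addr_ge0.
have M0 : 0 < K * s + M by lra.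
have K2 : 0 < 4 * K ^+ 2 by rewrite mulr_gt0// exprn_gt0.
apply: (@le_trans _ _ (4 * K ^+ 2 *
    (h ^+ 2 / (K * s + (Ml + Mr)) - h ^+ 2 / (K * s + M)))); last first.
  rewrite ler_pM2l// lerB//.
  have -> : K * s + (Ml + Mr) = (K * sl + Ml) + (K * sr + Mr).
    by rewrite /s; ring.
  exact: sqr_add_div_le.
have -> : 4 * K ^+ 2 * (h ^+ 2 / (K * s + (Ml + Mr)) - h ^+ 2 / (K * s + M)) =
  h ^+ 2 * (4 * K ^+ 2 * (M - (Ml + Mr)) / ((K * s + (Ml + Mr)) * (K * s + M))).
  by field; rewrite !gt_eqF.
have -> : a * (h / s) ^+ 2 = h ^+ 2 * (a / s ^+ 2) by field; rewrite gt_eqF.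
rewrite ler_wpM2l ?sqr_ge0//.
rewrite ler_pdivrMr ?exprn_gt0// mulrAC ler_pdivlMr ?mulr_gt0//.
(* Since [Ml + Mr <= M <= K * s], both denominators are at most [2 * (K * s)]; this is where the
   factor [4 * K ^+ 2] comes from. *)
have h1 : (K * s + (Ml + Mr)) * (K * s + M) <= 4 * K ^+ 2 * s ^+ 2.
  have -> : 4 * K ^+ 2 * s ^+ 2 = (2 * (K * s)) * (2 * (K * s)) by ring.
  by apply: ler_pM; [exact: ltW|exact: ltW|lra|lra].
apply: (@le_trans _ _ (a * (4 * K ^+ 2 * s ^+ 2))); first by rewrite ler_wpM2l.
have -> : 4 * K ^+ 2 * (M - (Ml + Mr)) * s ^+ 2 =
          (M - (Ml + Mr)) * (4 * K ^+ 2 * s ^+ 2) by ring.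
rewrite ler_wpM2r ?mulr_ge0 ?sqr_ge0//; lra.
Qed.

(** Both sides are the variance, for the masses [sl] and [sr], of the averages [hl / sl] and
    [hr / sr], whose mean is [(hl + hr) / (sl + sr)]. *)
Lemma bessel_step (R : realFieldType) (sl sr hl hr : R) : 0 < sl -> 0 < sr ->
  sl * (hl / sl - (hl + hr) / (sl + sr)) ^+ 2 +
  sr * (hr / sr - (hl + hr) / (sl + sr)) ^+ 2 =
  hl ^+ 2 / sl + hr ^+ 2 / sr - (hl + hr) ^+ 2 / (sl + sr).
Proof.
move=> sl0 sr0; have s0 : 0 < sl + sr by rewrite addr_gt0.
by field; rewrite !gt_eqF.
Qed.

Lemma haar_weight_le (R : realFieldType) (wl wr vl vr : R) :
  0 < wl -> 0 < wr -> 0 <= vl -> 0 <= vr ->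
  (wl ^+ 2 * vr + wr ^+ 2 * vl) / (wl + wr) ^+ 2 <= vl + vr.
Proof.
move=> wl0 wr0 vl0 vr0; rewrite ler_pdivrMr ?exprn_gt0 ?addr_gt0//.
rewrite mulrDl addrC; apply: lerD; rewrite mulrC ler_wpM2l//.
  by rewrite ler_sqr ?nnegrE ?addr_ge0 ?ltW// ltrDr.
by rewrite ler_sqr ?nnegrE ?addr_ge0 ?ltW// ltrDl.
Qed.

(** Here [s1] and [w1] belong to one half, [s], [w] and [v] to the whole interval. The A_2 bound
    gives [s1 * lam <= s * v <= A * w ^+ 2], and doubling replaces [w] by [D * w1]. *)
Lemma average_sqr_le (R : realFieldType) (A D w w1 s s1 v lam : R) :
  0 < w1 -> 0 < w -> 0 < s1 -> s1 <= s -> 0 <= lam -> lam <= v ->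
  w <= D * w1 -> s * v <= A * w ^+ 2 ->
  (s1 / w1) ^+ 2 * lam <= A * D ^+ 2 * s1.
Proof.
move=> w10 w0 s10 s1s lam0 lamv wD sA.
rewrite expr_div_n mulrAC ler_pdivrMr ?exprn_gt0//.
have A0 : 0 <= A.
  have : 0 <= A * w ^+ 2.
    by apply: le_trans sA; rewrite mulr_ge0//; lra.
  by rewrite pmulr_lge0// exprn_gt0.
have -> : s1 ^+ 2 * lam = s1 * (s1 * lam) by ring.
have -> : A * D ^+ 2 * s1 * w1 ^+ 2 = s1 * (A * (D * w1) ^+ 2) by ring.
rewrite ler_pM2l//; apply: (@le_trans _ _ (s * v)).
  by apply: ler_pM => //; exact: ltW.
apply: (le_trans sA); rewrite ler_wpM2l// ler_sqr ?nnegrE//; lra.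
Qed.

(* The potential [P] is the sum of the Bellman function of the Carleson embedding
   theorem and of the Bessel defect; [m] stands for the Carleson sum below the
   interval. *)
Lemma square_step (R : realFieldType)
    (K A D wl wr sl sr vl vr hl hr fl fr M Ml Mr : R)
    (lam := (wl ^+ 2 * vr + wr ^+ 2 * vl) / (wl + wr) ^+ 2)
    (P := fun s h f m : R =>
       3 * (4 * K * (f - K * (h ^+ 2 / (K * s + m))) +
            A * D ^+ 2 * (f - h ^+ 2 / s))) :
  0 < K -> 0 < wl -> 0 < wr -> 0 < sl -> 0 < sr -> 0 <= vl -> 0 <= vr ->
  0 <= Ml -> 0 <= Mr ->
  (sr / wr - sl / wl) ^+ 2 * lam + Ml + Mr <= M -> M <= K * (sl + sr) ->
  wl + wr <= D * wl -> wl + wr <= D * wr ->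
  (sl + sr) * (vl + vr) <= A * (wl + wr) ^+ 2 ->
  (hr / wr - hl / wl) ^+ 2 * lam + P sl hl fl Ml + P sr hr fr Mr <=
  P (sl + sr) (hl + hr) (fl + fr) M.
Proof.
move=> K0 wl0 wr0 sl0 sr0 vl0 vr0 Ml0 Mr0 aM MK Dl Dr sA.
have w0 : 0 < wl + wr by rewrite addr_gt0.
have lam0 : 0 <= lam.
  by rewrite divr_ge0 ?sqr_ge0// addr_ge0// mulr_ge0// sqr_ge0.
have lamv : lam <= vl + vr by exact: haar_weight_le.
have a0 : 0 <= (sr / wr - sl / wl) ^+ 2 * lam by rewrite mulr_ge0// sqr_ge0.
have c1 := @carleson_step R K sl sr hl hr _ M Ml Mr K0 sl0 sr0 a0 Ml0 Mr0 aM MK.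
have bs := @bessel_step R sl sr hl hr sl0 sr0.
have ml : (sl / wl) ^+ 2 * lam <= A * D ^+ 2 * sl.
  by apply: (@average_sqr_le _ _ _ (wl + wr) wl (sl + sr) _ (vl + vr)) => //; lra.
have mr : (sr / wr) ^+ 2 * lam <= A * D ^+ 2 * sr.
  by apply: (@average_sqr_le _ _ _ (wl + wr) wr (sl + sr) _ (vl + vr)) => //; lra.
set q := (hl + hr) / (sl + sr) in c1 bs.
(* A discrete product rule for [h / w = (s / w) * (h / s)], with [h / s] compared to its mean [q].
   The first term is handled by [carleson_step], the other two by [bessel_step]. *)
have e : hr / wr - hl / wl = (sr / wr - sl / wl) * q +
    (sr / wr) * (hr / sr - q) - (sl / wl) * (hl / sl - q).
  by field; rewrite !gt_eqF.
have := @sqr_add3_le R ((sr / wr - sl / wl) * q) ((sr / wr) * (hr / sr - q))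
   ((sl / wl) * (hl / sl - q)).
rewrite -e => /(ler_wpM2r lam0) h1.
have h2 := ler_wpM2r (sqr_ge0 (hl / sl - q)) ml.
have h3 := ler_wpM2r (sqr_ge0 (hr / sr - q)) mr.
rewrite /P.
move: h1 h2 h3 c1 bs.
rewrite (exprMn 2 _ q) (exprMn 2 _ (hr / sr - q)) (exprMn 2 _ (hl / sl - q)).
set x1 := (hr / wr - hl / wl) ^+ 2.
set x2 := (sr / wr - sl / wl) ^+ 2.
set x3 := (hr / sr - q) ^+ 2.
set x4 := (hl / sl - q) ^+ 2.
set x5 := q ^+ 2.
set x6 := hl ^+ 2 / (K * sl + Ml).
set x7 := hr ^+ 2 / (K * sr + Mr).
set x8 := (hl + hr) ^+ 2 / (_ + M).
set x9 := hl ^+ 2 / sl.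
set x10 := hr ^+ 2 / sr.
set x11 := (hl + hr) ^+ 2 / _.
set x12 := (sr / wr) ^+ 2.
set x13 := (sl / wl) ^+ 2.
move=> h1 h2 h3 c1 bs.
have bs' := congr1 ( *%R (A * D ^+ 2)) bs.
(* The middle expression equals the potential of the whole interval: the [f] terms are additive and
   cancel. It remains to bound [x1 * lam] by the Carleson gain plus the Bessel gain. *)
apply: (@le_trans _ _ (3 * (4 * K ^+ 2 * (x6 + x7 - x8) +
   A * D ^+ 2 * (x9 + x10 - x11)) + 
   3 * (4 * K * (fl - K * x6) + A * D ^+ 2 * (fl - x9)) +
   3 * (4 * K * (fr - K * x7) + A * D ^+ 2 * (fr - x10)))); last first.
  by rewrite le_eqVlt; apply/orP; left; apply/eqP; ring.
rewrite lerD2r lerD2r -bs'.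
apply: (le_trans h1).
have -> : 3 * (x2 * x5 + x12 * x3 + x13 * x4) * lam =
  3 * (x2 * lam * x5 + (x13 * lam * x4 + x12 * lam * x3)) by ring.
rewrite ler_pM2l//; apply: lerD => //.
have -> : A * D ^+ 2 * (sl * x4 + sr * x3) =
  A * D ^+ 2 * sl * x4 + A * D ^+ 2 * sr * x3 by ring.
exact: lerD.
Qed.

(** * Finite dyadic trees and telescoping along them *)

Fixpoint descendants (n : nat) (J : dyadic) : seq dyadic :=
  if n is m.+1 then
    J :: descendants m (lchild J) ++ descendants m (rchild J)
  else [::].

(** At each node the potential pays for [b J] and hands the potentials of the halves down; what
    remains below the last level is nonnegative and is dropped. *)
Lemma sum_descendants_le (R : realFieldType) (b P : dyadic -> R) :
  (forall J, 0 <= P J) ->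
  (forall J, b J + P (lchild J) + P (rchild J) <= P J) ->
  forall n J, \sum_(I <- descendants n J) b I <= P J.
Proof.
move=> P0 bP; elim=> [|n IH] J /=; first by rewrite big_nil.
rewrite big_cons big_cat/=; apply: le_trans (bP J).
by rewrite -addrA lerD2l lerD.
Qed.

Lemma level_ancestor n (I : dyadic) : (iter n parent I).1 = I.1 - n%:Z.
Proof. elim: n => [|n IH] /=; [lia|rewrite IH; lia]. Qed.

Lemma child_parent (I : dyadic) :
  I = lchild (parent I) \/ I = rchild (parent I).
Proof.
case: I => j k; rewrite /lchild /rchild /parent /=.
have [h|h] : k = (2 * (k %/ 2)%Z)%R \/ k = (2 * (k %/ 2)%Z + 1)%R by lia.
- by left; congr pair; lia.
- by right; congr pair; lia.
Qed.

Lemma descendants_leq m n I J : (m <= n)%N ->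
  I \in descendants m J -> I \in descendants n J.
Proof.
elim: m n J => // m IH [//|n] J mn /=.
rewrite !inE !mem_cat => /or3P[->//|h|h].
- by rewrite (IH n _ _ h) ?orbT.
- by rewrite (IH n _ _ h) ?orbT.
Qed.

Lemma mem_descendants_ancestor n I : I \in descendants n.+1 (iter n parent I).
Proof.
elim: n => [|n IH]; first by rewrite /= inE eqxx.
rewrite iterS; set K := iter n parent I in IH *.
change (I \in parent K :: descendants n.+1 (lchild (parent K)) ++
  descendants n.+1 (rchild (parent K))).
by rewrite inE mem_cat; case: (child_parent K) => <-; rewrite IH !orbT.
Qed.

(** The sequence [s] may have repetitions. One copy of each member of [X] is removed from it in
    turn, and uniqueness of [X] keeps the later members available. *)
Lemma ler_sum_subset (R : realFieldType) (T : eqType) (b : T -> R)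
    (X s : seq T) :
  (forall x, 0 <= b x) -> uniq X -> {subset X <= s} ->
  \sum_(x <- X) b x <= \sum_(x <- s) b x.
Proof.
move=> b0; elim: X s => [|x X IH] s; first by rewrite big_nil sumr_ge0.
move=> /= /andP[xX uX] Xs.
have xs : x \in s by apply: Xs; rewrite mem_head.
rewrite big_cons (big_rem x xs)/=.
rewrite lerD2l IH// => y yX.
apply: rem_mem; first by apply: contraNneq xX => <-.
by apply: Xs; rewrite inE yX orbT.
Qed.

(** A finite family need not lie below one dyadic interval, since none contains points on both sides
    of 0. It is covered instead by finitely many trees with distinct roots on one common level, so
    that the roots are disjoint. *)
Lemma sum_dyadic_le (R : realFieldType) (b P : dyadic -> R) (X : seq dyadic) :
  (forall I, 0 <= b I) -> uniq X ->
  (forall n J, \sum_(I <- descendants n J) b I <= P J) ->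
  exists L, exists2 s : seq dyadic,
    uniq s /\ (forall r, r \in s -> r.1 = L) &
    \sum_(I <- X) b I <= \sum_(r <- s) P r.
Proof.
move=> b0 uX bP.
(* The roots are the ancestors of the members of [X] of length [2 ^ N]. *)
pose N := (\max_(I <- X) `|I.1|)%N.
have XN I : I \in X -> (`|I.1| <= N)%N.
  by move=> IX; rewrite /N (big_rem I)//= leq_maxl.
(* For members of [X] the integer [I.1 + N] is nonnegative, so [absz] only turns it into the number
   of generations to climb. *)
pose root (I : dyadic) := iter (absz (I.1 + N%:Z)) parent I.
exists (- N%:Z), (undup (map root X)).
  split; first exact: undup_uniq.
  move=> r; rewrite mem_undup => /mapP[I /XN IN ->].
  by rewrite level_ancestor; move: (I.1 : int) IN => i; lia.
(* Members of [X] have levels between [-N] and [N] and the roots have level [-N], so [2 * N + 1]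
   levels, counting that of the root, suffice. *)
apply: (@le_trans _ _ (\sum_(I <- flatten
    [seq descendants (2 * N).+1 r | r <- undup (map root X)]) b I)).
  apply: ler_sum_subset => // I IX; apply/flattenP.
  exists (descendants (2 * N).+1 (root I)).
    by apply: map_f; rewrite mem_undup map_f.
  apply: descendants_leq (mem_descendants_ancestor _ _).
  by have := XN _ IX; move: (I.1 : int) => i; lia.
by rewrite big_flatten big_map; apply: ler_sum => r _.
Qed.

(** * Geometry of dyadic intervals and sums indexed by them *)

Section dyadic_geometry.
Variable R : realType.
Local Notation dset := (dyadic_set R).

Lemma measurable_dyadic I : measurable (dset I).
Proof. exact: measurable_itv. Qed.

Lemma dyadic_length_gt0 I : (0 < lebesgue_measure (dset I))%E.
Proof.
rewrite /dyadic_set lebesgue_measure_itv/= lte_fin ltr_pM2r ?exprz_gt0//.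
by rewrite ltr_int ltrDl ltr01 -EFinB lte_fin -mulrBl mulr_gt0 ?exprz_gt0//
  subr_gt0 ltr_int ltrDl.
Qed.

Lemma dyadic_neq0 I : dset I !=set0.
Proof.
apply/set0P/eqP => I0; have := dyadic_length_gt0 I.
by rewrite I0 measure0 ltxx.
Qed.

Lemma dyadic_disjoint I J : I.1 = J.1 -> I != J -> dset I `&` dset J = set0.
Proof.
case: I J => [j k] [_ l] /= <- kl; rewrite /dyadic_set /=.
have p : 0 < 2 ^ (- j) :> R by rewrite exprz_gt0.
apply/seteqP; split => // x [] /=; rewrite !in_itv/= => /andP[a b] /andP[c d].
have := le_lt_trans a d; have := le_lt_trans c b.
rewrite !ltr_pM2r// !ltr_int => h1 h2; move/eqP: kl; apply.
by congr pair; lia.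
Qed.

Lemma children_disjoint I : dset (lchild I) `&` dset (rchild I) = set0.
Proof.
apply: dyadic_disjoint => //; apply/eqP => -[]; lia.
Qed.

Lemma lchild_subset I : dset (lchild I) `<=` dset I.
Proof. by rewrite [X in _ `<=` X]dyadic_setU; exact: subsetUl. Qed.

Lemma rchild_subset I : dset (rchild I) `<=` dset I.
Proof. by rewrite [X in _ `<=` X]dyadic_setU; exact: subsetUr. Qed.

(** The three index sets on the left are disjoint parts of [subdyadics R J]: a nonempty set cannot
    lie in both halves, and if [J] lay in one half, so would the other half. *)
Lemma esum_subdyadics_le (a : dyadic -> \bar R) J : (forall I, 0 <= a I)%E ->
  (a J + \esum_(I in subdyadics R (lchild J)) a I +
   \esum_(I in subdyadics R (rchild J)) a I <=
   \esum_(I in subdyadics R J) a I)%E.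
Proof.
move=> a0; rewrite -{1}(@esum_set1 R _ J a)//.
have disj (A : dyadic) : dset A `<=` dset (lchild J) ->
    dset A `<=` dset (rchild J) -> False.
  move=> Al Ar; have [x Ax] := dyadic_neq0 A.
  have : (dset (lchild J) `&` dset (rchild J)) x by split; [exact: Al|exact: Ar].
  by rewrite children_disjoint.
rewrite !(esum_mkcond (subdyadics _ _)) (esum_mkcond [set J]).
have ge0 (S : set dyadic) I : [set: dyadic] I ->
  (0 <= if I \in S then a I else 0)%E by case: ifP.
rewrite -!esumD//; try by [exact: ge0|move=> I _; rewrite adde_ge0 ?ge0].
apply: le_esum => I _.
have [/set_mem -> {I}|IJ] := boolP (I \in [set J]).
  have Jl : J \in subdyadics R (lchild J) = false.
    apply/negbTE/negP => /set_mem JJ; apply: (disj (rchild J)) => //.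
    exact: subset_trans (@rchild_subset J) JJ.
  have Jr : J \in subdyadics R (rchild J) = false.
    apply/negbTE/negP => /set_mem JJ; apply: (disj (lchild J)) => //.
    exact: subset_trans (@lchild_subset J) JJ.
  by rewrite Jl Jr !adde0 [J \in subdyadics R J]mem_set.
rewrite add0e.
have [/set_mem Il|Il] := boolP (I \in _).
  rewrite ifF ?adde0; last by apply/negbTE/negP => /set_mem; exact: disj.
  by rewrite [I \in subdyadics R J]mem_set//; exact: subset_trans Il (@lchild_subset J).
rewrite add0e; have [/set_mem Ir|Ir] := boolP (I \in _); last exact: ge0.
by rewrite [I \in subdyadics R J]mem_set//; exact: subset_trans Ir (@rchild_subset J).
Qed.
End dyadic_geometry.

(** The enumeration by [pickle] makes monotone convergence for series applicable; numbers that
    encode no interval contribute 0. *)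
Lemma esum_dyadic_series (R : realType) (a : dyadic -> \bar R) :
  (forall I, 0 <= a I)%E ->
  (\esum_(I in [set: dyadic]) a I =
   \sum_(n <oo) oapp a 0 (pickle_inv n : option dyadic))%E.
Proof.
move=> a0.
have b0 n : (0 <= oapp a 0 (pickle_inv n : option dyadic))%E.
  by case: (pickle_inv n).
rewrite nneseries_esumT// (esumID (range (pickle : dyadic -> nat)))//.
rewrite !setTI esum_image; last by move=> I J _ _; exact: (pcan_inj pickleK).
rewrite [X in (_ + X)%E]esum1 ?adde0; last first.
  move=> n nr; case E : (pickle_inv n) => [I|//]; exfalso; apply: nr.
  by exists I => //; have := @pickle_invK dyadic n; rewrite E.
by apply: eq_esum => I _; rewrite pickleK_inv.
Qed.

(** Every interval is a left or a right half of exactly one parent, and parity of the index rules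
    out being both. *)
Lemma esum_dyadic_children (R : realType) (a : dyadic -> \bar R) :
  (forall I, 0 <= a I)%E ->
  (\esum_(I in [set: dyadic]) a I =
   \esum_(I in [set: dyadic]) (a (lchild I) + a (rchild I)))%E.
Proof.
move=> a0; rewrite (esumID (range lchild))// esumD// !setTI.
have -> : ~` range lchild = range rchild.
  apply/seteqP; split=> I.
    move=> Il; case: (child_parent I) => E; last by rewrite E; exists (parent I).
    by exfalso; apply: Il; rewrite E; exists (parent I).
  move=> [J _ <-] [K _]; case: J K => [j k] [j' k'] [/=]; lia.
rewrite (esum_image [set: dyadic] lchild a); last first.
  by move=> I J _ _; exact: (can_inj lchildK).
rewrite (esum_image [set: dyadic] rchild a)// => I J _ _.
exact: (can_inj rchildK).
Qed.

(** * Masses of weights on dyadic intervals *)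

Section mass.
Variable R : realType.
Local Notation mu := (@lebesgue_measure R).
Local Notation dset := (dyadic_set R).
Implicit Types (f u v w : R -> R) (I J : dyadic).

Lemma ae_imply (P Q : R -> Prop) : (forall x, P x -> Q x) ->
  {ae mu, forall x, P x} -> {ae mu, forall x, Q x}.
Proof. by move=> PQ; apply: filterS; first exact: (ae_filter_ringOfSetsType mu). Qed.

Lemma ae_imply2 (P Q S : R -> Prop) : (forall x, P x -> Q x -> S x) ->
  {ae mu, forall x, P x} -> {ae mu, forall x, Q x} -> {ae mu, forall x, S x}.
Proof. by move=> PQ; apply: filterS2; first exact: (ae_filter_ringOfSetsType mu). Qed.

Lemma weight_measurable w : weight w -> measurable_fun setT w.
Proof. by move=> [[]]. Qed.

Lemma weight_integrable w I : weight w -> mu.-integrable (dset I) (EFin \o w).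
Proof.
move=> [[mw _ wK] _].
have II : dset I `<=` `[I.2%:~R * 2 ^ (- I.1), (I.2 + 1)%:~R * 2 ^ (- I.1)].
  by apply: subset_itvl; rewrite bnd_simp.
apply: (@integrableS _ _ _ mu _ _ _ _ _ II) => //.
  exact: measurable_dyadic.
apply/integrableP; split; last exact: wK (@segment_compact _ _ _).
by apply/measurable_EFinP; exact: measurable_funS mw.
Qed.

(** A weight is positive only almost everywhere; passing to [|w|] gives an integrand that is
    nonnegative at every point. *)
Lemma weight_integral_abs w (D : set R) : measurable D -> weight w ->
  (\int[mu]_(x in D) (w x)%:E = \int[mu]_(x in D) `|w x|%:E)%E.
Proof.
move=> mD hw; have mw := weight_measurable hw.
have mwD : measurable_fun D w by exact: measurable_funS mw.
apply: ae_eq_integral => //.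
- exact/measurable_EFinP.
- by apply/measurable_EFinP; exact: measurableT_comp.
- by apply: ae_imply hw.2 => x wx _; rewrite gtr0_norm.
Qed.

Lemma weight_mass_abs w I : weight w ->
  (\int[mu]_(x in dset I) `|w x|%:E)%E = (mass w I)%:E.
Proof.
move=> hw; rewrite -weight_integral_abs//; last exact: measurable_dyadic.
rewrite /mass /Rintegral fineK//; apply: integrable_fin_num.
  exact: measurable_dyadic.
exact: weight_integrable.
Qed.

Lemma mass_ge0 w I : weight w -> 0 <= mass w I.
Proof.
move=> hw; rewrite -lee_fin -weight_mass_abs//; apply: integral_ge0 => x _.
by rewrite lee_fin.
Qed.

(** Zero mass would make [w] vanish almost everywhere on the interval. As [w] is positive almost
    everywhere, the interval would then be null, although its length is positive. *)
Lemma mass_gt0 w I : weight w -> 0 < mass w I.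
Proof.
move=> hw; rewrite lt_neqAle mass_ge0// andbT eq_sym; apply/eqP => w0.
have mI : measurable (dset I) by exact: measurable_dyadic.
have mwI : measurable_fun (dset I) (EFin \o w).
  by apply/measurable_EFinP; exact: measurable_funS (weight_measurable hw).
have /(ae_eq_integral_abs mu mI mwI) wI :
    (\int[mu]_(x in dset I) `|(EFin \o w) x| = 0)%E.
  by have := weight_mass_abs I hw; rewrite w0.
have : {ae mu, forall x, ~ dset I x}.
  apply: ae_imply2 wI hw.2 => x /= wx wx0 Ix; move: wx0.
  by have [->] := wx Ix; rewrite ltxx.
move=> [N [mN N0 IN]]; have := dyadic_length_gt0 R I; rewrite ltNge => /negP; apply.
rewrite -N0; apply: le_measure; rewrite ?inE// => x Ix; apply: IN => /=.
by move=> /(_ Ix).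
Qed.

Lemma mass_split f I : mu.-integrable (dset I) (EFin \o f) ->
  mass f I = mass f (lchild I) + mass f (rchild I).
Proof.
move=> If; rewrite {1}/mass dyadic_setU Rintegral_setU//.
- exact: measurable_dyadic.
- exact: measurable_dyadic.
- by rewrite -dyadic_setU.
- by apply/eqP; exact: children_disjoint.
Qed.

(** Monotone convergence along the enumeration of the intervals, after [v] is replaced by [|v|] to
    have nonnegative terms everywhere. *)
Lemma integral_dyadic_sum (c : dyadic -> R) v :
  (forall I, 0 <= c I) -> weight v ->
  (\int[mu]_(x in [set: R])
     ((\esum_(I in [set: dyadic]) (c I * \1_(dset I) x)%:E) * (v x)%:E) =
   \esum_(I in [set: dyadic]) (c I * mass v I)%:E)%E.
Proof.
move=> c0 hv; have mv := weight_measurable hv.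
pose g n x := oapp (fun I => (c I * \1_(dset I) x)%:E) 0%E
  (pickle_inv n : option dyadic).
have g0 n x : (0 <= g n x)%E.
  by rewrite /g; case: (pickle_inv n) => //= I; rewrite lee_fin mulr_ge0.
have mg n : measurable_fun setT (g n).
  rewrite /g; case: (pickle_inv n) => //= I.
  apply/measurable_EFinP; apply: measurable_funM => //.
  by apply: measurable_indic; exact: measurable_dyadic.
have E x : (\esum_(I in [set: dyadic]) (c I * \1_(dset I) x)%:E =
    \sum_(n <oo) g n x)%E.
  by rewrite esum_dyadic_series// => I; rewrite lee_fin mulr_ge0.
under eq_integral do rewrite E.
have mabs : measurable_fun setT (fun x => `|v x|%:E).
  by apply/measurable_EFinP; exact: measurableT_comp.
have mG : measurable_fun setT (fun x => \sum_(n <oo) g n x)%E.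
  exact: (@ge0_emeasurable_sum _ _ _ _ _ xpredT).
have mvG : measurable_fun setT (fun x => \sum_(n <oo) (`|v x|%:E * g n x))%E.
  apply: (@ge0_emeasurable_sum _ _ _ _ _ xpredT) => [n x _ _|n _].
    by rewrite mule_ge0.
  exact: emeasurable_funM mabs (mg n).
rewrite (@ae_eq_integral _ _ _ mu setT
  (fun x => \sum_(n <oo) (`|v x|%:E * g n x))%E)//; last 2 first.
- by apply: emeasurable_funM => //; exact/measurable_EFinP.
- by apply: ae_imply hv.2 => x vx _; rewrite muleC nneseriesZl// gtr0_norm.
rewrite integral_nneseries//; last 2 first.
- by move=> n; exact: emeasurable_funM mabs (mg n).
- by move=> n x _; rewrite mule_ge0.
rewrite esum_dyadic_series; last first.
  by move=> I; rewrite lee_fin mulr_ge0// mass_ge0.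
apply: eq_eseriesr => n _; rewrite /g.
case: (pickle_inv n) => [I|] /=; last first.
  by rewrite (eq_integral (cst 0%E)) ?integral0// => x _; rewrite mule0.
have -> : (fun x => `|v x|%:E * (c I * \1_(dset I) x)%:E)%E =
  (fun x => (c I)%:E * (`|v x|%:E * (\1_(dset I) x)%:E))%E.
  by apply/funext => x; rewrite EFinM muleCA.
have mind : measurable_fun setT (fun x => (\1_(dset I) x)%:E : \bar R).
  by apply/measurable_EFinP; apply: measurable_indic; exact: measurable_dyadic.
rewrite ge0_integralZl_EFin//; last exact: emeasurable_funM mabs mind.
have -> : (fun x => `|v x|%:E * (\1_(dset I) x)%:E)%E =
    (fun x => `|v x|%:E) \_ (dset I) by rewrite epatch_indic.
by rewrite -integral_mkcond weight_mass_abs.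
Qed.
End mass.

(** The optimal choice is [t = G / F]. If [F = 0] and [G > 0], then [t = s / G + 1] yields the
    contradiction [2 * (s + G) <= s]. *)
Lemma sqr_le_of_quadratic (R : realFieldType) (G F s : R) :
  0 <= F -> 0 <= s -> 0 <= G ->
  (forall t, 0 <= t -> 2 * t * G <= t ^+ 2 * F + s) -> G ^+ 2 <= F * s.
Proof.
move=> F0 s0 G0 h; have [->|Gn0] := eqVneq G 0; first by rewrite expr0n mulr_ge0.
have Gp : 0 < G by rewrite lt_neqAle eq_sym Gn0.
have [F00|Fn0] := eqVneq F 0.
  have := h (s / G + 1) _; rewrite F00 mulr0 add0r addr_ge0 ?divr_ge0//.
  have -> : 2 * (s / G + 1) * G = 2 * (s + G) by field.
  by move=> /(_ isT) ?; lra.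
have Fp : 0 < F by rewrite lt_neqAle eq_sym Fn0.
have := h (G / F) (divr_ge0 G0 F0).
have -> : 2 * (G / F) * G = 2 * (G ^+ 2 / F) by field.
have -> : (G / F) ^+ 2 * F + s = G ^+ 2 / F + s by field.
by move=> ?; rewrite mulrC -ler_pdivrMr//; lra.
Qed.

(** * Functions in L^2(u): integrability against [w] and Cauchy-Schwarz *)

Section square_integrable.
Variables (R : realType) (u w : R -> R).
Hypotheses (hu : weight u) (hw : weight w).
Let s x := (u x)^-1 * w x ^+ 2.
Hypothesis (hs : locally_integrable setT s).
Local Notation mu := (@lebesgue_measure R).
Local Notation dset := (dyadic_set R).

Lemma dual_weight : weight s.
Proof.
split=> //; apply: ae_imply2 hu.2 hw.2 => x ux wx.
by rewrite mulr_gt0 ?invr_gt0 ?exprn_gt0.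
Qed.

Variable f : R -> R.
Hypothesis f2 : in_L2 u f.
Let F x := f x ^+ 2 * u x.

Lemma measurable_sqr_weight : measurable_fun setT F.
Proof.
apply: measurable_funM; last exact: weight_measurable.
by apply: measurable_funX; exact: f2.1.
Qed.

Lemma integral_sqr_weight_abs (D : set R) : measurable D ->
  (\int[mu]_(x in D) (F x)%:E = \int[mu]_(x in D) `|F x|%:E)%E.
Proof.
move=> mD; have mFD := measurable_funS measurableT (@subsetT _ D) measurable_sqr_weight.
apply: ae_eq_integral => //.
- exact/measurable_EFinP.
- by apply/measurable_EFinP; exact: measurableT_comp.
- by apply: ae_imply hu.2 => x ux _; rewrite ger0_norm// mulr_ge0 ?sqr_ge0 ?ltW.
Qed.

Lemma integral_sqr_weight_ge0 : (0 <= \int[mu]_(x in [set: R]) (F x)%:E)%E.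
Proof.
by rewrite integral_sqr_weight_abs//; apply: integral_ge0 => x _; rewrite lee_fin.
Qed.

Lemma L2norm_EFin :
  L2norm u (EFin \o f) = sqrte (\int[mu]_(x in [set: R]) (F x)%:E)%E.
Proof.
congr sqrte; apply: eq_integral => x _; rewrite [(EFin \o f) x]/comp.
by rewrite abse_EFin -EFin_expe -EFinM real_normK ?num_real.
Qed.

Lemma integrable_sqr_weight : mu.-integrable setT (EFin \o F).
Proof.
apply/integrableP; split; first by apply/measurable_EFinP; exact: measurable_sqr_weight.
rewrite -[X in (X < _)%E]integral_sqr_weight_abs//.
have := f2.2; rewrite L2norm_EFin.
by case: (\int[_]_(_ in _) _)%E => //= r _; exact: ltry.
Qed.

Lemma integrable_sqr_weight_dyadic I : mu.-integrable (dset I) (EFin \o F).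
Proof.
apply: integrableS integrable_sqr_weight => //; exact: measurable_dyadic.
Qed.

Lemma mass_sqr_weight_abs I :
  (\int[mu]_(x in dset I) `|F x|%:E)%E = (mass F I)%:E.
Proof.
have mI := @measurable_dyadic R I.
rewrite -integral_sqr_weight_abs// /mass /Rintegral fineK//.
apply: integrable_fin_num => //; exact: integrable_sqr_weight_dyadic.
Qed.

Lemma mass_sqr_weight_ge0 I : 0 <= mass F I.
Proof.
by rewrite -lee_fin -mass_sqr_weight_abs; apply: integral_ge0 => x _; rewrite lee_fin.
Qed.

(** Pointwise, the right side minus the left side is [(t * |f| * u - w) ^+ 2 / u]. This one estimate
    yields both the integrability of [f * w] and Cauchy-Schwarz. *)
Lemma integral_abs_mul_le t I : 0 <= t ->
  (\int[mu]_(x in dset I) (2 * t * `|f x * w x|)%:E <=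
   (t ^+ 2 * mass F I + mass s I)%:E)%E.
Proof.
move=> t0; have mI := @measurable_dyadic R I.
have sub (g : R -> R) : measurable_fun setT g ->
    measurable_fun (dset I) (fun x => `|g x|%:E).
  move=> mg; apply/measurable_EFinP; apply: measurableT_comp => //.
  exact: measurable_funS mg.
have mF := sub _ measurable_sqr_weight.
have ms := sub _ (weight_measurable dual_weight).
have mfw : measurable_fun setT (fun x => f x * w x).
  by apply: measurable_funM; [exact: f2.1|exact: weight_measurable].
rewrite EFinD EFinM -mass_sqr_weight_abs -(weight_mass_abs I dual_weight).
rewrite -ge0_integralZl_EFin ?sqr_ge0// -ge0_integralD//; last 2 first.
- by move=> x _; rewrite mule_ge0// lee_fin sqr_ge0.
- exact: measurable_funeM.
apply: ae_ge0_le_integral => //.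
- by move=> x _; rewrite lee_fin !mulr_ge0.
- apply/measurable_EFinP; apply: measurable_funM => //.
  by apply/measurable_EFinP; exact: sub.
- by move=> x _; rewrite adde_ge0// mule_ge0// lee_fin sqr_ge0.
- by apply: emeasurable_funD => //; exact: measurable_funeM.
apply: ae_imply2 hu.2 hw.2 => x ux wx _.
have -> : `|F x| = `|f x| ^+ 2 * u x by rewrite normrM normrX (gtr0_norm ux).
have -> : `|s x| = (u x)^-1 * w x ^+ 2.
  by rewrite gtr0_norm// mulr_gt0 ?invr_gt0 ?exprn_gt0.
rewrite -EFinM -EFinD lee_fin normrM (gtr0_norm wx).
rewrite -subr_ge0; set a := `|f x|.
have -> : t ^+ 2 * (a ^+ 2 * u x) + (u x)^-1 * w x ^+ 2 - 2 * t * (a * w x) =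
  (u x)^-1 * (t * a * u x - w x) ^+ 2 by field; rewrite gt_eqF.
by rewrite mulr_ge0 ?sqr_ge0// invr_ge0 ltW.
Qed.

Lemma integrable_mul_weight I :
  mu.-integrable (dset I) (EFin \o (fun x => f x * w x)).
Proof.
have mI := @measurable_dyadic R I.
have mfw : measurable_fun setT (fun x => f x * w x).
  by apply: measurable_funM; [exact: f2.1|exact: weight_measurable].
apply/integrableP; split; first by apply/measurable_EFinP; exact: measurable_funS mfw.
(* The choice [t = 1/2] makes the factor [2 * t] equal to 1. *)
have t0 : 0 <= 2^-1 :> R by rewrite invr_ge0.
apply: (@le_lt_trans _ _ (\int[mu]_(x in dset I) (2 * 2^-1 * `|f x * w x|)%:E)%E).
  by under [leRHS]eq_integral do rewrite mulfV// mul1r.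
exact: le_lt_trans (integral_abs_mul_le I t0) (ltry _).
Qed.

(** Cauchy-Schwarz for [f * w = (f * u^(1/2)) * (u^(-1/2) * w)], obtained by optimising
    [integral_abs_mul_le] over [t]. *)
Lemma mass_mul_weight_sqr_le I :
  mass (fun x => f x * w x) I ^+ 2 <= mass F I * mass s I.
Proof.
have mI := @measurable_dyadic R I.
have iabs : mu.-integrable (dset I) (EFin \o (fun x => `|f x * w x|)).
  exact: integrable_norm (integrable_mul_weight I).
pose G := \int[mu]_(x in dset I) `|f x * w x|.
have G0 : 0 <= G by apply: Rintegral_ge0.
apply: (@le_trans _ _ (G ^+ 2)).
  rewrite -[X in X <= _](real_normK (num_real _)) ler_sqr ?nnegrE//.
  by apply: le_normr_Rintegral => //; exact: integrable_mul_weight.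
apply: sqr_le_of_quadratic => //; first exact: mass_sqr_weight_ge0.
  exact: mass_ge0 dual_weight.
move=> t t0; rewrite -RintegralZl// -lee_fin.
apply: le_trans (integral_abs_mul_le I t0).
rewrite /Rintegral fineK//; apply: integrable_fin_num => //.
by apply: eq_integrable (integrableZl _ _ iabs) => //.
Qed.

End square_integrable.

(** This is the integral over [I], against [v], of the square of the unnormalised Haar function for
    [w]: [w(I^-) / w(I)] on the right half and [- w(I^+) / w(I)] on the left half, of mean zero
    against [w]. *)
Definition haar_weight (R : realType) (w v : R -> R) (I : dyadic) : R :=
  (mass w (lchild I) ^+ 2 * mass v (rchild I) +
   mass w (rchild I) ^+ 2 * mass v (lchild I)) / mass w I ^+ 2.

Lemma ereal_sup_lty (R : realType) (T : Type) (a : T -> R) :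
  (ereal_sup [set (a t)%:E | t in [set: T]] < +oo)%E <->
  exists2 C : R, 0 < C & forall t, a t <= C.
Proof.
split=> [|[C C0 aC]]; last first.
  apply: (@le_lt_trans _ _ C%:E); last exact: ltry.
  by apply: ge_ereal_sup => _ [t _ <-]; rewrite lee_fin.
set m := ereal_sup _ => moo.
have am t : ((a t)%:E <= m)%E by apply: ereal_sup_ubound; exists t.
exists (`|fine m| + 1) => [|t]; first by rewrite ltr_wpDl.
have := am t; move: moo; case: m {am} => //= r _; rewrite lee_fin => ar.
by rewrite (le_trans ar)// (le_trans (ler_norm r))// lerDl.
Qed.

(** * The square function norm as a sum of weighted differences *)

Section haar_expansion.
Variables (R : realType) (v w : R -> R).
Hypotheses (hv : weight v) (hw : weight w).
Local Notation mu := (@lebesgue_measure R).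
Local Notation dset := (dyadic_set R).

Lemma haar_weight_ge0 I : 0 <= haar_weight w v I.
Proof.
by rewrite divr_ge0 ?sqr_ge0// addr_ge0// mulr_ge0 ?sqr_ge0// mass_ge0.
Qed.

Variable f : R -> R.
Hypothesis fw : forall I, mu.-integrable (dset I) (EFin \o (fun x => f x * w x)).

(** The average over [I] is the convex combination of those over its halves with coefficients
    [w(I^-) / w(I)] and [w(I^+) / w(I)]. The jump from [I] to a half is therefore, up to sign,
    [wDelta] times the coefficient of the opposite half. *)
Lemma sqr_wDelta I :
  `|wavg w f (lchild I) - wavg w f I| ^+ 2 * mass v (lchild I) +
  `|wavg w f (rchild I) - wavg w f I| ^+ 2 * mass v (rchild I) =
  `|wDelta w f I| ^+ 2 * haar_weight w v I.
Proof.
rewrite !real_normK ?num_real// /wDelta /haar_weight /wavg.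
rewrite -/(mass (fun x => f x * w x) I) -/(mass _ (lchild I)) -/(mass _ (rchild I)).
rewrite (mass_split (fw I)) (mass_split (weight_integrable I hw)).
have l0 := mass_gt0 (lchild I) hw; have r0 := mass_gt0 (rchild I) hw.
by field; rewrite !gt_eqF// addr_gt0.
Qed.

Lemma L2norm_sqfun :
  L2norm v (sqfun w f) =
  sqrte (\esum_(I in [set: dyadic]) (`|wDelta w f I| ^+ 2 * haar_weight w v I)%:E)%E.
Proof.
pose c I := `|wavg w f I - wavg w f (parent I)| ^+ 2.
have c0 I : 0 <= c I by exact: sqr_ge0.
have -> : L2norm v (sqfun w f) =
    sqrte (\esum_(I in [set: dyadic]) (c I * mass v I)%:E)%E.
  rewrite -integral_dyadic_sum//; congr sqrte; apply: eq_integral => x _.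
  rewrite /sqfun gee0_abs ?sqrte_ge0// sqr_sqrte//; apply: esum_ge0 => I _.
  by rewrite lee_fin mulr_ge0.
congr sqrte; rewrite esum_dyadic_children => [|I]; last first.
  by rewrite lee_fin mulr_ge0// mass_ge0.
by apply: eq_esum => I _; rewrite -sqr_wDelta /c lchildK rchildK.
Qed.

End haar_expansion.

(** Both norms are square roots, so squaring turns boundedness with constant [C] into a quadratic
    estimate with [C ^+ 2]; the way back takes [Num.sqrt C]. *)
Lemma sqfun_boundedP (R : realType) (u v w : R -> R) :
  weight u -> weight v -> weight w ->
  locally_integrable setT (fun x => (u x)^-1 * w x ^+ 2) ->
  sqfun_bounded w u v <->
  exists2 C : R, 0 < C & forall f, in_L2 u f ->
    (\esum_(I in [set: dyadic]) (`|wDelta w f I| ^+ 2 * haar_weight w v I)%:E <=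
     C%:E * \int[lebesgue_measure]_(x in [set: R]) (f x ^+ 2 * u x)%:E)%E.
Proof.
move=> hu hv hw hs.
split=> [[C C0 H]|[C C0 H]].
  exists (C ^+ 2); first exact: exprn_gt0.
  move=> f f2; have := H f f2.
  rewrite (L2norm_sqfun hv hw (integrable_mul_weight hu hw hs f2)).
  have -> : C%:E = sqrte (C ^+ 2)%:E by rewrite EFin_expe sqrte_sqr gee0_abs ?lee_fin ?ltW.
  rewrite L2norm_EFin -sqrteM ?lee_fin ?sqr_ge0// lee_sqrt//.
  by rewrite mule_ge0 ?lee_fin ?sqr_ge0// integral_sqr_weight_ge0.
exists (Num.sqrt C); first by rewrite sqrtr_gt0.
move=> f f2; rewrite (L2norm_sqfun hv hw (integrable_mul_weight hu hw hs f2)).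
rewrite L2norm_EFin (_ : (Num.sqrt C)%:E = sqrte C%:E)//.
have C0' : (0 <= C%:E)%E by rewrite lee_fin ltW.
rewrite -sqrteM// lee_sqrt; first exact: H.
by apply: mule_ge0 => //; exact: integral_sqr_weight_ge0.
Qed.

(** Distinct intervals of one level are disjoint, so their masses add up to at most the integral
    over the line. *)
Lemma sum_mass_sqr_weight_le (R : realType) (u f : R -> R) L (s : seq dyadic) :
  weight u -> in_L2 u f -> uniq s -> (forall r, r \in s -> r.1 = L) ->
  ((\sum_(r <- s) mass (fun x => f x ^+ 2 * u x) r)%:E <=
   \int[lebesgue_measure]_(x in [set: R]) (f x ^+ 2 * u x)%:E)%E.
Proof.
move=> hu f2 us sL.
rewrite -sumEFin; under eq_bigr do rewrite -mass_sqr_weight_abs//.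
rewrite (integral_sqr_weight_abs hu f2)//.
have mF := measurable_sqr_weight hu f2.
have mabs : measurable_fun setT (fun x => `|f x ^+ 2 * u x|%:E).
  by apply/measurable_EFinP; exact: measurableT_comp.
have mI (r : dyadic) : measurable (dyadic_set R r) by exact: measurable_dyadic.
have tr : trivIset [set` s] (dyadic_set R).
  apply/trivIsetP => I J /= Is Js; apply: dyadic_disjoint.
  by rewrite (sL I Is) (sL J Js).
rewrite -ge0_integral_bigsetU//; last first.
  exact: (measurable_funS measurableT (@subsetT _ _) mabs).
by apply: ge0_subset_integral => //; apply: bigsetU_measurable => r _; exact: mI.
Qed.

Lemma measurable_invr (R : realType) (f : R -> R) :
  measurable_fun setT f -> measurable_fun setT (fun x => (f x)^-1).
Proof.
move=> mf.
(* [powR] is only an inverse on nonnegative reals, hence the squaring. *)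
have -> : (fun x => (f x)^-1) = (fun x => f x * (f x ^+ 2) `^ (-1)).
  apply/funext => x; rewrite powR_inv1 ?sqr_ge0//.
  have [->|f0] := eqVneq (f x) 0; first by rewrite invr0 mul0r.
  by field.
apply: measurable_funM => //.
apply: (measurableT_comp (measurable_powR (-1))).
exact: measurable_funX.
Qed.

(** * Condition (i) in terms of masses, and the test functions *)

Section embedding.
Variables (R : realType) (u v w : R -> R).
Hypotheses (hu : weight u) (hv : weight v) (hw : weight w).
Let s x := (u x)^-1 * w x ^+ 2.
Hypothesis hs : locally_integrable setT s.
Local Notation mu := (@lebesgue_measure R).
Local Notation dset := (dyadic_set R).
Let g x := (u x)^-1 * w x.
Let ws : weight s := dual_weight hu hw hs.

Lemma wavg_dual I : wavg w g I = (mass w I)^-1 * mass s I.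
Proof.
rewrite /wavg; congr (_ * _); apply: eq_Rintegral => x _.
by rewrite /g /s -mulrA -expr2.
Qed.

(** The two averages are [s(I) / w(I)] and [v(I) / w(I)]; the second uses that [v * w^-1 * w = v]
    holds almost everywhere, namely where [w] is nonzero. *)
Lemma dyadic_A2E :
  dyadic_A2 w (fun x => u x * (w x)^-1) (fun x => v x * (w x)^-1) <->
  exists2 A : R, 0 < A & forall I, mass s I * mass v I <= A * mass w I ^+ 2.
Proof.
have E I : wavg w (fun x => (u x * (w x)^-1)^-1) I *
    wavg w (fun x => v x * (w x)^-1) I = mass s I * mass v I / mass w I ^+ 2.
  have -> : wavg w (fun x => (u x * (w x)^-1)^-1) I = wavg w g I.
    by rewrite /wavg; under eq_Rintegral do rewrite invfM invrK.
  rewrite wavg_dual.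
  have -> : wavg w (fun x => v x * (w x)^-1) I = (mass w I)^-1 * mass v I.
    congr (_ * fine _); apply: ae_eq_integral.
    - exact: measurable_dyadic.
    - apply/measurable_EFinP; apply: (measurable_funS measurableT) => //.
      apply: measurable_funM; last exact: weight_measurable.
      apply: measurable_funM; first exact: weight_measurable.
      by apply: measurable_invr; exact: weight_measurable.
    - apply/measurable_EFinP; apply: (measurable_funS measurableT) => //.
      exact: weight_measurable.
    - by apply: ae_imply hw.2 => x wx _; rewrite mulfVK// gt_eqF.
  by have w0 := mass_gt0 I hw; field; rewrite gt_eqF.
split=> [/ereal_sup_lty[A A0 H]|[A A0 H]].
  exists A => // I; have := H I; rewrite E ler_pdivrMr// exprn_gt0//.
  exact: mass_gt0.
apply/ereal_sup_lty; exists A => // I.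
by rewrite E ler_pdivrMr// exprn_gt0// mass_gt0.
Qed.

Lemma dyadic_doubling_child :
  dyadic_doubling w -> exists2 D : R, 0 < D & forall I,
    mass w I <= D * mass w (lchild I) /\ mass w I <= D * mass w (rchild I).
Proof.
move=> /ereal_sup_lty[D D0 H]; exists D => // I.
have := H (lchild I); have := H (rchild I); rewrite lchildK rchildK.
by rewrite !ler_pdivrMr// ?mass_gt0.
Qed.

Section test_function.
Variable J : dyadic.
Let f x := g x * \1_(dset J) x.

Let mf : measurable_fun setT f.
Proof.
apply: measurable_funM.
  apply: measurable_funM; last exact: weight_measurable.
  by apply: measurable_invr; exact: weight_measurable.
by apply: measurable_indic; exact: measurable_dyadic.
Qed.

(** On [J] one has [f ^+ 2 * u = s] wherever [u] is nonzero, and also [f * w = s]: this is the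
    equality case of Cauchy-Schwarz on [J]. *)
Let int_f2 : (\int[mu]_(x in [set: R]) (f x ^+ 2 * u x)%:E = (mass s J)%:E)%E.
Proof.
have mJ : measurable (dset J) by exact: measurable_dyadic.
have iJ := weight_integrable J ws.
rewrite (_ : (mass s J)%:E = (\int[mu]_(x in dset J) (s x)%:E)%E); last first.
  rewrite /mass /Rintegral fineK//; exact: integrable_fin_num.
rewrite [RHS]integral_mkcond; apply: ae_eq_integral => //.
- apply/measurable_EFinP; apply: measurable_funM; last exact: weight_measurable.
  exact: measurable_funX.
- have : mu.-integrable setT ((EFin \o s) \_ (dset J)).
    by rewrite -integrable_mkcond.
  by case/integrableP.
- apply: ae_imply hu.2 => x ux _; rewrite patchE /f indicE.
  case: ifP => _ /=; last by rewrite mulr0 expr0n mul0r.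
  by congr EFin; rewrite mulr1 /g /s; field; rewrite gt_eqF.
Qed.

Lemma test_in_L2 : in_L2 u f.
Proof.
by split=> //; rewrite (L2norm_EFin u f) int_f2 /= ltry.
Qed.

Lemma mass_test I : dset I `<=` dset J -> mass (fun x => f x * w x) I = mass s I.
Proof.
move=> IJ; apply: eq_Rintegral => x /set_mem Ix.
rewrite /f indicE mem_set ?mulr1; last exact: IJ.
by rewrite /g /s -mulrA -expr2.
Qed.

Lemma mass_test0 I : dset I `&` dset J = set0 ->
  mass (fun x => f x * w x) I = 0.
Proof.
move=> IJ; transitivity (\int[mu]_(x in dset I) (0 : R)); last first.
  by rewrite /Rintegral integral0.
apply: eq_Rintegral => x /set_mem Ix; rewrite /f indicE memNset ?mulr0 ?mul0r// => Jx.
by have : (dset I `&` dset J) x by []; rewrite IJ.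
Qed.

Lemma sum_test_le C : (forall f, in_L2 u f ->
    (\esum_(I in [set: dyadic]) (`|wDelta w f I| ^+ 2 * haar_weight w v I)%:E <=
     C%:E * \int[mu]_(x in [set: R]) (f x ^+ 2 * u x)%:E)%E) ->
  (\esum_(I in [set: dyadic]) (`|wDelta w f I| ^+ 2 * haar_weight w v I)%:E <=
   (C * mass s J)%:E)%E.
Proof. by move=> /(_ _ test_in_L2); rewrite int_f2 EFinM. Qed.

Lemma wDelta_test I : dset I `<=` dset J -> wDelta w f I = wDelta w g I.
Proof.
move=> IJ; rewrite {2}/wDelta !wavg_dual /wDelta /wavg.
congr (_ * _ - _ * _); apply: mass_test.
- exact: subset_trans (@rchild_subset R I) IJ.
- exact: subset_trans (@lchild_subset R I) IJ.
Qed.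

End test_function.

End embedding.

(** The masses [wj] and [wk] are those of [J] and its sibling. Dropping the term with [vk] and
    bounding [wj + wk] by [D * wk] lets [wk ^+ 2] cancel, along with one factor [s]. *)
Lemma A2_of_child_bound (R : realFieldType) (C D wj wk s v vk : R) :
  0 < wj -> 0 < wk -> 0 < s -> 0 <= v -> 0 <= vk -> wj + wk <= D * wk ->
  (s / wj) ^+ 2 * ((wk ^+ 2 * v + wj ^+ 2 * vk) / (wj + wk) ^+ 2) <= C * s ->
  s * v <= D ^+ 2 * C * wj ^+ 2.
Proof.
move=> wj0 wk0 s0 v0 vk0 hD h.
have W0 : 0 < wj + wk by rewrite addr_gt0.
have C0 : 0 <= C.
  have : 0 <= C * s.
    apply: le_trans h; rewrite mulr_ge0 ?sqr_ge0// divr_ge0 ?sqr_ge0//.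
    by rewrite addr_ge0// mulr_ge0 ?sqr_ge0.
  by rewrite pmulr_lge0.
have h1 : s ^+ 2 * (wk ^+ 2 * v) <= C * s * (wj ^+ 2 * (wj + wk) ^+ 2).
  rewrite -ler_pdivrMr ?mulr_gt0 ?exprn_gt0//; apply: le_trans h.
  have -> : s ^+ 2 * (wk ^+ 2 * v) / (wj ^+ 2 * (wj + wk) ^+ 2) =
      (s / wj) ^+ 2 * (wk ^+ 2 * v / (wj + wk) ^+ 2).
    by field; rewrite !gt_eqF.
  rewrite ler_wpM2l ?sqr_ge0// ler_pM2r ?invr_gt0 ?exprn_gt0//.
  by rewrite lerDl mulr_ge0 ?sqr_ge0.
have h2 : (wj + wk) ^+ 2 <= (D * wk) ^+ 2.
  by rewrite ler_sqr ?nnegrE//; lra.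
rewrite -(ler_pM2l (mulr_gt0 s0 (exprn_gt0 2 wk0))).
have -> : s * wk ^+ 2 * (s * v) = s ^+ 2 * (wk ^+ 2 * v) by ring.
apply: (le_trans h1).
have -> : s * wk ^+ 2 * (D ^+ 2 * C * wj ^+ 2) =
  C * s * (wj ^+ 2 * (D * wk) ^+ 2) by ring.
by rewrite ler_wpM2l ?mulr_ge0 ?(ltW s0)// ler_wpM2l ?sqr_ge0.
Qed.

(** * Necessity and sufficiency of the two conditions *)

Section characterization.
Variables (R : realType) (u v w : R -> R).
Hypotheses (hu : weight u) (hv : weight v) (hw : weight w).
Let s x := (u x)^-1 * w x ^+ 2.
Hypothesis hs : locally_integrable setT s.
Local Notation mu := (@lebesgue_measure R).
Local Notation dset := (dyadic_set R).
Let g x := (u x)^-1 * w x.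
Let ws : weight s := dual_weight hu hw hs.
Local Notation lam := (haar_weight w v).

Let lam0 I : 0 <= lam I := haar_weight_ge0 w hv I.

Let split_mass (f : R -> R) (hf : weight f) I :
  mass f I = mass f (lchild I) + mass f (rchild I) :=
  mass_split (weight_integrable I hf).

Lemma A2_necessary C D :
  (forall I,
    mass w I <= D * mass w (lchild I) /\ mass w I <= D * mass w (rchild I)) ->
  (forall f, in_L2 u f ->
    (\esum_(I in [set: dyadic]) (`|wDelta w f I| ^+ 2 * lam I)%:E <=
     C%:E * \int[mu]_(x in [set: R]) (f x ^+ 2 * u x)%:E)%E) ->
  forall J, mass s J * mass v J <= D ^+ 2 * C * mass w J ^+ 2.
Proof.
move=> hD HC J; pose f x := (u x)^-1 * w x * \1_(dset J) x.
have Hf : (\esum_(I in [set: dyadic]) (`|wDelta w f I| ^+ 2 * lam I)%:E <=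
    (C * mass s J)%:E)%E by exact: (sum_test_le hu hw hs).
set K := parent J.
(* A single term of the sum is kept: on [K] the difference is, up to sign, the average of the test
   function over [J]. *)
have HK : `|wDelta w f K| ^+ 2 * lam K <= C * mass s J.
  rewrite -lee_fin; apply: le_trans Hf; apply: esum_ge.
  by exists [set K]; [split|rewrite fsbig_set1].
have [hl hr] := hD K; rewrite (split_mass hw K) in hl hr.
have wl0 := mass_gt0 (lchild K) hw; have wr0 := mass_gt0 (rchild K) hw.
have vl0 := mass_ge0 (lchild K) hv; have vr0 := mass_ge0 (rchild K) hv.
have HJ : mass (fun x => f x * w x) J = mass s J by exact: mass_test.
rewrite real_normK ?num_real// /haar_weight (split_mass hw K) in HK.
have sJ := mass_gt0 J ws.
have [EJ|EJ] := child_parent J; rewrite -/K in EJ.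
- have Hr : mass (fun x => f x * w x) (rchild K) = 0.
    by apply: mass_test0; rewrite [in dset J]EJ setIC children_disjoint.
  have DK : wDelta w f K = - ((mass w (lchild K))^-1 * mass s J).
    rewrite /wDelta /wavg -!/(mass _ _) Hr mulr0 sub0r.
    by rewrite -EJ HJ.
  have := @A2_of_child_bound _ C D _ _ (mass s J) _ _ wl0 wr0 sJ vl0 vr0 hr.
  rewrite -EJ; apply.
  apply: le_trans HK; rewrite DK sqrrN -EJ.
  by rewrite [_ / mass w J]mulrC [X in _ * (X / _)]addrC.
- have Hl : mass (fun x => f x * w x) (lchild K) = 0.
    by apply: mass_test0; rewrite [in dset J]EJ children_disjoint.
  have DK : wDelta w f K = (mass w (rchild K))^-1 * mass s J.
    rewrite /wDelta /wavg -!/(mass _ _) Hl mulr0 subr0.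
    by rewrite -EJ HJ.
  rewrite addrC in hl.
  have := @A2_of_child_bound _ C D _ _ (mass s J) _ _ wr0 wl0 sJ vr0 vl0 hl.
  rewrite -EJ; apply.
  apply: le_trans HK; rewrite DK -EJ.
  by rewrite [_ / mass w J]mulrC [mass w J + _]addrC.
Qed.

Lemma carleson_necessary C :
  (forall f, in_L2 u f ->
    (\esum_(I in [set: dyadic]) (`|wDelta w f I| ^+ 2 * lam I)%:E <=
     C%:E * \int[mu]_(x in [set: R]) (f x ^+ 2 * u x)%:E)%E) ->
  forall J, (\esum_(I in subdyadics R J) (`|wDelta w g I| ^+ 2 * lam I)%:E <=
    (C * mass s J)%:E)%E.
Proof.
move=> HC J; apply: le_trans (sum_test_le hu hw hs J HC).
(* Intervals inside [J] see the test function as [g]; all other terms on the right are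
   nonnegative. *)
rewrite esum_mkcond; apply: le_esum => I _; case: ifPn => [/set_mem IJ|_].
  by rewrite (wDelta_test u w IJ).
by rewrite lee_fin mulr_ge0 ?sqr_ge0.
Qed.

Lemma carleson_sufficient A C D : 0 < A -> 0 < C ->
  (forall I,
    mass w I <= D * mass w (lchild I) /\ mass w I <= D * mass w (rchild I)) ->
  (forall I, mass s I * mass v I <= A * mass w I ^+ 2) ->
  (forall J, (\esum_(I in subdyadics R J) (`|wDelta w g I| ^+ 2 * lam I)%:E <=
    (C * mass s J)%:E)%E) ->
  forall f, in_L2 u f ->
    (\esum_(I in [set: dyadic]) (`|wDelta w f I| ^+ 2 * lam I)%:E <=
     (3 * (4 * C + A * D ^+ 2))%:E *
       \int[mu]_(x in [set: R]) (f x ^+ 2 * u x)%:E)%E.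
Proof.
move=> A0 C0 hD hA hC f f2.
pose H := mass (fun x => f x * w x); pose F := mass (fun x => f x ^+ 2 * u x).
pose a I := `|wDelta w g I| ^+ 2 * lam I.
have a0 I : 0 <= a I by rewrite mulr_ge0 ?sqr_ge0.
pose E J := (\esum_(I in subdyadics R J) (a I)%:E)%E.
have E0 J : (0 <= E J)%E by apply: esum_ge0 => I _; rewrite lee_fin.
have Efin J : E J \is a fin_num.
  by rewrite ge0_fin_numE//; exact: le_lt_trans (hC J) (ltry _).
pose M J := fine (E J).
have M0 J : 0 <= M J by exact: fine_ge0.
have MC J : M J <= C * mass s J by rewrite -lee_fin fineK//; exact: hC.
have aM J : a J + M (lchild J) + M (rchild J) <= M J.
  rewrite -lee_fin !EFinD !fineK//; apply: esum_subdyadics_le => I.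
  by rewrite lee_fin.
have HF J : H J ^+ 2 <= F J * mass s J by exact: (mass_mul_weight_sqr_le hu hw hs f2 J).
(* The potential of [square_step], with the Carleson constant [C] as [K] and the actual Carleson sum
   [M J] as [m]. *)
pose P J := 3 * (4 * C * (F J - C * (H J ^+ 2 / (C * mass s J + M J))) +
            A * D ^+ 2 * (F J - H J ^+ 2 / mass s J)).
have s0 J : 0 < mass s J by exact: mass_gt0.
have F0 J : 0 <= F J by exact: (mass_sqr_weight_ge0 hu f2 J).
have c0 : 0 <= 4 * C by rewrite mulr_ge0 ?(ltW C0).
have d0 : 0 <= A * D ^+ 2 by rewrite mulr_ge0 ?sqr_ge0 ?(ltW A0).
have Cs0 J : 0 < C * mass s J by rewrite mulr_gt0.
have CsM0 J : 0 < C * mass s J + M J by rewrite ltr_wpDr.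
(* As [M J] is nonnegative, the left side is at most [H J ^+ 2 / mass s J], hence at most [F J] by
   Cauchy-Schwarz. With [h2] this makes the potential nonnegative. *)
have h1 J : C * (H J ^+ 2 / (C * mass s J + M J)) <= F J.
  rewrite mulrA ler_pdivrMr//.
  apply: (@le_trans _ _ (C * (F J * mass s J))); first by rewrite ler_pM2l.
  by rewrite mulrCA ler_wpM2l// lerDl.
have h2 J : H J ^+ 2 / mass s J <= F J by rewrite ler_pdivrMr.
have P0 J : 0 <= P J.
  by rewrite /P mulr_ge0// addr_ge0// mulr_ge0// subr_ge0.
have PF J : P J <= 3 * (4 * C + A * D ^+ 2) * F J.
  rewrite /P -[leRHS]mulrA ler_pM2l// [leRHS]mulrDl; apply: lerD; apply: ler_wpM2l => //.
    by rewrite gerBl mulr_ge0 ?(ltW C0)// divr_ge0 ?sqr_ge0 ?ltW.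
  by rewrite gerBl divr_ge0 ?sqr_ge0 ?ltW.
have fw := integrable_mul_weight hu hw hs f2.
have step J : `|wDelta w f J| ^+ 2 * lam J + P (lchild J) + P (rchild J) <= P J.
  have Ha : a J = (mass s (rchild J) / mass w (rchild J) -
      mass s (lchild J) / mass w (lchild J)) ^+ 2 * lam J.
    by rewrite /a real_normK ?num_real// /wDelta !wavg_dual // ![_^-1 * _]mulrC.
  have Hd : `|wDelta w f J| ^+ 2 = (H (rchild J) / mass w (rchild J) -
      H (lchild J) / mass w (lchild J)) ^+ 2.
    by rewrite real_normK ?num_real// /wDelta /wavg ![_^-1 * _]mulrC.
  have [] := (hD J, (hA J, (MC J, aM J))); rewrite Ha Hd /P /haar_weight.
  rewrite [H J](mass_split (fw J)).
  rewrite [F J](mass_split (integrable_sqr_weight_dyadic hu f2 J)).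
  rewrite !(split_mass hw J) !(split_mass ws J) !(split_mass hv J).
  move=> [hl hr] [hAJ [hMC haM]].
  by apply: square_step => //; rewrite ?mass_gt0 ?mass_ge0.
(* The infinite sum is a supremum over finite sets of intervals, so a bound uniform in the finite
   set [X] is enough. *)
rewrite -[leLHS]/(ereal_sup _); apply: ge_ereal_sup => _ [X [finX _] <-].
rewrite fsbig_finite//= sumEFin.
have b0 I : 0 <= `|wDelta w f I| ^+ 2 * lam I by rewrite mulr_ge0 ?sqr_ge0.
have [L [r [ur rL] Xr]] :=
  sum_dyadic_le b0 (finmap.fset_uniq (fset_set X)) (sum_descendants_le P0 step).
apply: (@le_trans _ _ (3 * (4 * C + A * D ^+ 2) * \sum_(I <- r) F I)%:E).
  rewrite lee_fin; apply: (le_trans Xr); rewrite mulr_sumr.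
  by apply: ler_sum.
rewrite EFinM; apply: lee_wpmul2l; first by rewrite lee_fin mulr_ge0// addr_ge0.
exact: (sum_mass_sqr_weight_le hu f2 ur rL).
Qed.

End characterization.

Theorem corollary1 (R : realType) (u v w : R -> R)
    (hu : weight u) (hv : weight v) (hw : weight w)
    (hdoubling : dyadic_doubling w)
    (hloc : locally_integrable setT (fun x : R => (u x)^-1 * w x ^+ 2))
    (hvloc : locally_integrable setT v) :
  sqfun_bounded w u v <->
  dyadic_A2 w (fun x => u x * (w x)^-1) (fun x => v x * (w x)^-1) /\
  (exists2 C : R, 0 < C & forall J : dyadic,
    ((mass w J)^-1%:E *
       (\esum_(I in subdyadics R J)
         (`|wDelta w (fun x => (u x)^-1 * w x) I| ^+ 2 *
          ((mass w (lchild I) ^+ 2 * mass v (rchild I) +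
            mass w (rchild I) ^+ 2 * mass v (lchild I)) /
           mass w I ^+ 2))%:E)
     <= (C * wavg w (fun x => (u x)^-1 * w x) J)%:E)%E).
Proof.
have [D D0 hD] := dyadic_doubling_child hw hdoubling.
(* Multiplying by [w(J)] turns the inequality of (ii) into the unnormalised Carleson condition with
   the same constant. *)
have normalize (C : R) J (e : \bar R) :
    ((mass w J)^-1%:E * e <= (C * wavg w (fun x => ((u x)^-1 * w x)%R) J)%:E <->
     e <= (C * mass (fun x => ((u x)^-1 * w x ^+ 2)%R) J)%:E)%E.
  have w0 := mass_gt0 J hw.
  rewrite wavg_dual mulrCA EFinM lee_pmul2l//.
  by rewrite lte_fin invr_gt0.
split=> [/(sqfun_boundedP hu hv hw hloc)[C C0 HC]|].
  split.
    apply/(dyadic_A2E u hv hw); exists (D ^+ 2 * C).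
      by rewrite mulr_gt0 ?exprn_gt0.
    exact: (A2_necessary hu hv hw hloc hD HC).
  exists C => // J; apply/normalize.
  exact: (carleson_necessary hu hv hw hloc HC).
move=> [/(dyadic_A2E u hv hw)[A A0 hA] [C C0 hC]].
apply/(sqfun_boundedP hu hv hw hloc); exists (3 * (4 * C + A * D ^+ 2)).
  by rewrite mulr_gt0// addr_gt0 ?mulr_gt0 ?exprn_gt0.
apply: (carleson_sufficient hu hv hw hloc A0 C0 hD hA) => J.
exact: (normalize _ _ _).1 (hC J).
Qed.
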